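(* Let $\mathbf A,\mathbf B\in\mathbb R^{n\times n}$ be s.p.d. matrices with $\operatorname{rank}(\mathbf A)\ge\operatorname{rank}(\mathbf B)$. Call $\mathbf N_{12}:\mathcal H_2\to\mathcal H_1$ admissible if $\mathcal R(\mathbf N_{12})\subset\mathcal N(\mathbf B_{11}^{1/2}\mathbf G_{11})$ and $\mathbf N_{12}^*\mathbf N_{12}\preceq\mathbf B/\mathbf A$, and let $\boldsymbol\Gamma_t^{\mathbf N_{12}}$ be the associated matrices (see context). 1. For every admissible $\mathbf N_{12}$, the path $\boldsymbol\Gamma^{\mathbf N_{12}}:[0,1]\to\mathbb R^{n\times n}$, $t\mapsto\boldsymbol\Gamma_t^{\mathbf N_{12}}$, is a constant-speed geodesic, that is, $\mathcal W_2(\boldsymbol\Gamma_s^{\mathbf N_{12}},\boldsymbol\Gamma_t^{\mathbf N_{12}})=(s-t)\,\mathcal W_2(\mathbf A,\mathbf B)$ for any $0\le t\le s\le1$. 2. Conversely, any constant-speed geodesic connecting $\mathbf A$ and $\mathbf B$ is of this form. 3. The rank of $\boldsymbol\Gamma_t^{\mathbf N_{12}}$ is constant for $t\in(0,1)$ and equals $\operatorname{rank}(\mathbf A)+\operatorname{rank}(\mathbf B/\mathbf A-\mathbf N_{12}^*\mathbf N_{12})$.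
   Context: s.p.d. means symmetric positive semidefinite, $^*$ is the transpose, $^\dagger$ the Moore–Penrose pseudoinverse, $\mathbf C^{\dagger/2}:=(\mathbf C^{1/2})^\dagger$. $\mathcal W_2^2(\mathbf A,\mathbf B)=\operatorname{tr}\mathbf A+\operatorname{tr}\mathbf B-2\operatorname{tr}(\mathbf A^{1/2}\mathbf B\mathbf A^{1/2})^{1/2}$. A constant-speed geodesic connecting $\mathbf A$ and $\mathbf B$ is a path $\boldsymbol\Gamma$ from $[0,1]$ to the s.p.d. matrices with $\boldsymbol\Gamma_0=\mathbf A$, $\boldsymbol\Gamma_1=\mathbf B$ and $\mathcal W_2(\boldsymbol\Gamma_s,\boldsymbol\Gamma_t)=|s-t|\mathcal W_2(\mathbf A,\mathbf B)$. Block notation with respect to $\mathcal H_1=\mathcal R(\mathbf A)$ (range), $\mathcal H_2=\mathcal N(\mathbf A)$ (null space): $\mathbf A_{11}=\mathbf A|_{\mathcal H_1}$ is invertible, $\mathbf B_{ij}:\mathcal H_j\to\mathcal H_i$, and $\mathbf B/\mathbf A:=\mathbf B_{22}-\mathbf B_{21}\mathbf B_{11}^\dagger\mathbf B_{12}$ on $\mathcal H_2$. Fix $\mathbf G_{11}:\mathcal H_1\to\mathcal H_1$ with $\mathbf G_{11}\mathbf G_{11}^*=\mathbf A_{11}$ and let $\mathbf G=\begin{pmatrix}\mathbf G_{11}&\mathbf 0\\\mathbf 0&\mathbf 0\end{pmatrix}$. For admissible $\mathbf N_{12}$ choose any $\mathbf M_{22}:\mathcal H_2\to\mathcal H_2$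 with $\mathbf M_{22}\mathbf M_{22}^*=\mathbf B/\mathbf A-\mathbf N_{12}^*\mathbf N_{12}$, set $$\mathbf M=\begin{pmatrix}(\mathbf G_{11}^* )^{-1}(\mathbf G_{11}^*\mathbf B_{11}\mathbf G_{11})^{1/2}&\mathbf 0\\\mathbf B_{21}\mathbf G_{11}(\mathbf G_{11}^*\mathbf B_{11}\mathbf G_{11})^{\dagger/2}+\mathbf N_{12}^*&\mathbf M_{22}\end{pmatrix},$$ $\mathbf G_t=(1-t)\mathbf G+t\mathbf M$ and $\boldsymbol\Gamma_t^{\mathbf N_{12}}=\mathbf G_t\mathbf G_t^*$; this does not depend on the choice of $\mathbf M_{22}$. *)

(* Defs.v *)
From HB Require Import structures.
From mathcomp Require Import all_boot all_order all_algebra.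
From mathcomp Require Import boolp classical_sets reals.

Set Implicit Arguments.
Unset Strict Implicit.
Unset Printing Implicit Defensive.
Import Order.TTheory GRing.Theory Num.Theory.
Local Open Scope classical_set_scope.
Local Open Scope ring_scope.

Section SymmetricPositiveSemidefinite.
Context {R : realType}.

Definition psdmx n (X : 'M[R]_n) : Prop :=
  X^T = X /\ forall v : 'cV[R]_n, 0 <= (v^T *m X *m v) 0 0.

Definition loewner_le n (X Y : 'M[R]_n) : Prop := psdmx (Y - X).

(* The positive semidefinite square root; the default 0 is only returned
   when X is not positive semidefinite. *)
Definition sqrtmx n (X : 'M[R]_n) : 'M[R]_n :=
  xget 0 [set S | psdmx S /\ S *m S = X].

Definition penrose p q (X : 'M[R]_(p, q)) (Y : 'M[R]_(q, p)) : Prop :=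
  [/\ X *m Y *m X = X, Y *m X *m Y = Y,
      (X *m Y)^T = X *m Y & (Y *m X)^T = Y *m X].

(* Not mxalgebra's pinvmx, which is a generalized inverse that need not
   satisfy the two symmetry conditions. *)
Definition mp_pinv p q (X : 'M[R]_(p, q)) : 'M[R]_(q, p) :=
  xget 0 [set Y | penrose X Y].

(* Matrices act on column vectors here, whereas mxalgebra encodes subspaces as
   row spaces: a subspace of R^p is given by a matrix whose rows, transposed,
   span it. *)
Definition colspace p q (X : 'M[R]_(p, q)) : 'M[R]_(q, p) := X^T.
Definition nullspace p q (X : 'M[R]_(p, q)) : 'M[R]_q := kermx X^T.

(* The columns of U form an orthonormal basis of the subspace S. *)
Definition onb_of n k p (U : 'M[R]_(n, k)) (S : 'M[R]_(p, n)) : Prop :=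
  U^T *m U = 1%:M /\ (colspace U == S)%MS.

End SymmetricPositiveSemidefinite.

Section BuresWasserstein.
Context {R : realType} {n : nat}.

Definition W2sq (A B : 'M[R]_n) : R :=
  \tr A + \tr B - 2 * \tr (sqrtmx (sqrtmx A *m B *m sqrtmx A)).

Definition W2 (A B : 'M[R]_n) : R := Num.sqrt (W2sq A B).

(* Only the values of Gamma on [0, 1] are relevant. *)
Definition constant_speed_geodesic (A B : 'M[R]_n) (Gamma : R -> 'M[R]_n) :=
  [/\ forall t : R, 0 <= t <= 1 -> psdmx (Gamma t),
      Gamma 0 = A,
      Gamma 1 = B
    & forall s t : R, 0 <= s <= 1 -> 0 <= t <= 1 ->
        W2 (Gamma s) (Gamma t) = `|s - t| * W2 A B].

End BuresWasserstein.

(* The columns of U1 and U2 are orthonormal bases of H1 = R(A) and H2 = N(A).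
   A linear map between these subspaces is identified with its matrix in
   these bases, so that composition, adjoint, pseudoinverse, square root and
   Loewner order are the matrix ones. *)
Section Blocks.
Context {R : realType} {n r m : nat}.
Variables (U1 : 'M[R]_(n, r)) (U2 : 'M[R]_(n, m)).

(* The block X_ij : H_j -> H_i is [block Ui Uj X]. *)
Definition block p q (U : 'M[R]_(n, p)) (V : 'M[R]_(n, q)) (X : 'M[R]_n) :
  'M[R]_(p, q) := U^T *m X *m V.

(* The operator on R^n = H1 (+) H2 with the given blocks. *)
Definition of_blocks (X11 : 'M[R]_r) (X12 : 'M[R]_(r, m))
    (X21 : 'M[R]_(m, r)) (X22 : 'M[R]_m) : 'M[R]_n :=
  row_mx U1 U2 *m block_mx X11 X12 X21 X22 *m (row_mx U1 U2)^T.

Variable B : 'M[R]_n.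

(* B / A *)
Definition schur : 'M[R]_m :=
  block U2 U2 B - block U2 U1 B *m mp_pinv (block U1 U1 B) *m block U1 U2 B.

Variable G11 : 'M[R]_r.

Definition admissible (N12 : 'M[R]_(r, m)) : Prop :=
  (colspace N12 <= nullspace (sqrtmx (block U1 U1 B) *m G11))%MS /\
  loewner_le (N12^T *m N12) schur.

Definition Gmx : 'M[R]_n := of_blocks G11 0 0 0.

Definition Mmx (N12 : 'M[R]_(r, m)) (M22 : 'M[R]_m) : 'M[R]_n :=
  let S := sqrtmx (G11^T *m block U1 U1 B *m G11) in
  of_blocks (invmx G11^T *m S)                           0
            (block U2 U1 B *m G11 *m mp_pinv S + N12^T)  M22.

Definition Gt (N12 : 'M[R]_(r, m)) (M22 : 'M[R]_m) (t : R) : 'M[R]_n :=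
  (1 - t) *: Gmx + t *: Mmx N12 M22.

Definition Gammat (N12 : 'M[R]_(r, m)) (M22 : 'M[R]_m) (t : R) : 'M[R]_n :=
  Gt N12 M22 t *m (Gt N12 M22 t)^T.

End Blocks.

(* Main.v *)
Require Import Defs.
From HB Require Import structures.
From mathcomp Require Import all_boot all_order all_algebra.
From mathcomp Require Import boolp classical_sets reals.
From mathcomp Require Import ring lra.
From mathcomp.real_closed Require Import complex.
Set Implicit Arguments.
Unset Strict Implicit.
Unset Printing Implicit Defensive.
Import Order.TTheory GRing.Theory Num.Theory.
Local Open Scope ring_scope.

(* Write A = X X^T and B = Y Y^T with square factors.  Polar decomposition shows
   that W_2^2(A, B) <= |X - Y|^2 (Frobenius norm), with equality exactly when
   X^T Y is positive semidefinite; call such factors aligned.  If X and Y are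
   aligned then so are (1 - s) X + s Y and (1 - t) X + t Y, so the segment from X
   to Y projects to a constant-speed geodesic; G and M are aligned.

   Conversely, let X be a factor of the midpoint of a geodesic and let Y, Z be
   factors of A and B aligned with X.  The equality case of the triangle
   inequality for the Frobenius norm gives X = (Y + Z) / 2 and aligns Y with Z.
   Since X^T Y dominates Y^T Y / 2, the factor of A aligned with X is unique, and
   likewise for B, so every other point of the geodesic comes from the segment
   from Y to Z.  Rotating Y onto G, the alignment of G and Z kills the block
   Z_12, makes Z_11 the corresponding block of M, and leaves N_12^T as the part
   of Z_21 that B does not determine. *)

Section BuresWassersteinGeodesics.
Context {R : realType}.

(** * Positive semidefinite matrices *)

Lemma trmxD m n (X Y : 'M[R]_(m, n)) : (X + Y)^T = X^T + Y^T.
Proof. exact: raddfD. Qed.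

Lemma trmxB m n (X Y : 'M[R]_(m, n)) : (X - Y)^T = X^T - Y^T.
Proof. exact: raddfB. Qed.

Lemma trmxZ m n (a : R) (X : 'M[R]_(m, n)) : (a *: X)^T = a *: X^T.
Proof. exact: linearZ. Qed.

Lemma psdmx0 n : psdmx (0 : 'M[R]_n).
Proof. by split=> [|v]; rewrite ?trmx0 // mulmx0 mul0mx mxE. Qed.

Lemma psdmxD n (X Y : 'M[R]_n) : psdmx X -> psdmx Y -> psdmx (X + Y).
Proof.
move=> [sX pX] [sY pY]; split=> [|v]; first by rewrite trmxD sX sY.
by rewrite mulmxDr mulmxDl mxE addr_ge0.
Qed.

Lemma psdmxZ n (a : R) (X : 'M[R]_n) : 0 <= a -> psdmx X -> psdmx (a *: X).
Proof.
move=> a0 [sX pX]; split=> [|v]; first by rewrite trmxZ sX.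
by rewrite -scalemxAr -scalemxAl mxE mulr_ge0.
Qed.

Lemma psdmx_conj m n (W : 'M[R]_(n, m)) (X : 'M[R]_n) :
  psdmx X -> psdmx (W^T *m X *m W).
Proof.
move=> [sX pX]; split=> [|v]; first by rewrite !trmx_mul trmxK sX mulmxA.
by have := pX (W *m v); rewrite trmx_mul !mulmxA.
Qed.

Lemma psdmx1 n : psdmx (1%:M : 'M[R]_n).
Proof.
split=> [|v]; first exact: trmx1.
rewrite mulmx1 mxE; apply: sumr_ge0 => i _.
by rewrite mxE -expr2 sqr_ge0.
Qed.

Lemma psdmx_gram m n (X : 'M[R]_(m, n)) : psdmx (X^T *m X).
Proof. by rewrite -[X^T]mulmx1; apply: psdmx_conj; apply: psdmx1. Qed.

Lemma psdmx_gramr m n (X : 'M[R]_(m, n)) : psdmx (X *m X^T).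
Proof. by rewrite -{1}[X]trmxK; apply: psdmx_gram. Qed.

Lemma psdmx_diag_ge0 n (X : 'M[R]_n) i : psdmx X -> 0 <= X i i.
Proof.
move=> [_ /(_ (delta_mx i 0))].
by rewrite trmx_delta -rowE -colE !mxE.
Qed.

Lemma psdmx_tr_ge0 n (X : 'M[R]_n) : psdmx X -> 0 <= \tr X.
Proof. by move=> pX; apply: sumr_ge0 => i _; apply: psdmx_diag_ge0. Qed.

Lemma psdmx_tr_eq0 n (X : 'M[R]_n) : psdmx X -> \tr X = 0 -> X = 0.
Proof.
move=> pX tX0.
have d0 i : X i i = 0.
  have /psumr_eq0P : forall j, true -> 0 <= X j j.
    by move=> j _; apply: psdmx_diag_ge0.
  by move=> /(_ tX0 i isT).
have [sX nX] := pX.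
have sXij i j : X j i = X i j by rewrite -[in LHS]sX mxE.
(* The form is evaluated at [e_i + c e_j]. The zero diagonal leaves only the cross term, and
   [c = 1], [c = -1] force it to vanish. *)
have tst i j (c : R) : 0 <= c * X i j *+ 2.
  have := nX (delta_mx i 0 + c *: delta_mx j 0).
  rewrite trmxD trmxZ !trmx_delta !mulmxDl -!scalemxAl !mulmxDr -!scalemxAr.
  rewrite -!rowE -!colE !mxE !d0 sXij.
  by congr (0 <= _); ring.
apply/matrixP=> i j; rewrite mxE.
have := tst i j 1; have := tst i j (-1); lra.
Qed.

Lemma gram_tr_ge0 m n (X : 'M[R]_(m, n)) : 0 <= \tr (X^T *m X).
Proof. exact/psdmx_tr_ge0/psdmx_gram. Qed.

Lemma gram_tr_eq0 m n (X : 'M[R]_(m, n)) : \tr (X^T *m X) = 0 -> X = 0.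
Proof.
move=> t0; apply/matrixP=> i j; rewrite mxE.
have /matrixP/(_ j j) := psdmx_tr_eq0 (psdmx_gram X) t0.
rewrite !mxE => /psumr_eq0P => /(_ _ i isT).
rewrite mxE => H; apply/eqP; rewrite -sqrf_eq0 expr2 H // => k _.
by rewrite mxE -expr2 sqr_ge0.
Qed.

Lemma gram_eq0 m n (X : 'M[R]_(m, n)) : X^T *m X = 0 -> X = 0.
Proof. by move=> X0; apply: gram_tr_eq0; rewrite X0 mxtrace0. Qed.

Lemma gramr_eq0 m n (X : 'M[R]_(m, n)) : X *m X^T = 0 -> X = 0.
Proof.
by rewrite -{1}[X]trmxK => /gram_eq0 /(congr1 trmx); rewrite trmxK trmx0.
Qed.

(* If D = S - T then S D + D T = 0, hence tr (D S D) + tr (D T D) = 0. *)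
Lemma psdmx_sqrt_unique n (S T : 'M[R]_n) :
  psdmx S -> psdmx T -> S *m S = T *m T -> S = T.
Proof.
move=> pS pT eST; have [D DE] : exists D, D = S - T by exists (S - T).
have sD : D^T = D by rewrite DE trmxB (proj1 pS) (proj1 pT).
have pDS : psdmx (D *m S *m D) by rewrite -{1}sD; apply: psdmx_conj.
have pDT : psdmx (D *m T *m D) by rewrite -{1}sD; apply: psdmx_conj.
have SD : S *m D + D *m T = 0.
  by rewrite DE mulmxBr mulmxBl eST addrA subrK subrr.
have : \tr (D *m S *m D) + \tr (D *m T *m D) = 0.
  rewrite [\tr (D *m T *m D)]mxtrace_mulC -!mulmxA -linearD /=.
  by rewrite -mulmxDr SD mulmx0 mxtrace0.
move/eqP; rewrite paddr_eq0 ?psdmx_tr_ge0 //.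
move=> /andP[/eqP/(psdmx_tr_eq0 pDS) DS0 /eqP/(psdmx_tr_eq0 pDT) DT0].
have D3 : D *m D *m D = 0.
  by rewrite {2}DE mulmxBr mulmxBl DS0 DT0 subrr.
have D2 : D *m D = 0.
  by apply: gram_eq0; rewrite trmx_mul !sD mulmxA D3 mul0mx.
by apply/eqP; rewrite -subr_eq0 -DE; apply/eqP/gram_eq0; rewrite sD.
Qed.

(** * Polynomial functional calculus: square roots and pseudoinverses *)

Lemma interpolation (s : seq R) (f : R -> R) :
  exists q : {poly R}, forall x, x \in s -> q.[x] = f x.
Proof.
elim: s => [|a s [q qE]]; first by exists 0.
have [as_|aNs] := boolP (a \in s).
  by exists q => x; rewrite inE => /predU1P[->|]; apply: qE.
(* [w] vanishes on [s] but not at [a], so a multiple of it corrects the value at [a] and keeps the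
   others. *)
pose w := \prod_(x <- s) ('X - x%:P).
have wa : w.[a] != 0 by rewrite -rootE root_prod_XsubC.
exists (q + ((f a - q.[a]) / w.[a]) *: w) => x.
rewrite hornerD hornerZ inE => /predU1P[->|xs].
  by rewrite divfK // addrC subrK.
have -> : w.[x] = 0 by apply/eqP; rewrite -rootE root_prod_XsubC.
by rewrite mulr0 addr0 qE.
Qed.

Lemma psdmx_eigenvalue_ge0 n (X : 'M[R]_n) (a : R) :
  psdmx X -> eigenvalue X a -> 0 <= a.
Proof.
move=> [_ pX] /eigenvalueP[v vX v0].
have := pX v^T; rewrite trmxK vX -scalemxAl mxE.
have vv : 0 < (v *m v^T) 0 0.
  have vv0 : 0 <= (v *m v^T) 0 0 by apply: psdmx_diag_ge0; apply: psdmx_gramr.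
  rewrite lt_neqAle vv0 andbT eq_sym; apply: contra v0 => /eqP H.
  apply/eqP/gramr_eq0; apply/matrixP=> i j.
  by rewrite !ord1 H mxE.
by rewrite pmulr_lge0.
Qed.

(** The spectral theorem in the form used below: polynomial identities in [X] can be checked on
    finitely many nonnegative reals. It comes from diagonalising [X] as a Hermitian matrix over
    [R[i]]. *)
Lemma psdmx_spectrum n (X : 'M[R]_n.+1) : psdmx X ->
  exists s : seq R, (forall x, x \in s -> 0 <= x) /\
    forall q : {poly R}, (forall x, x \in s -> q.[x] = 0) -> horner_mx X q = 0.
Proof.
move=> pX; pose XC : 'M[R[i]]_n.+1 := map_mx (real_complex R) X.
have sXC : XC \is hermsymmx.
  apply: realsym_hermsym.
    rewrite qualifE; apply/eqP; rewrite expr0 scale1r map_mx_id //.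
    by rewrite /XC map_trmx (proj1 pX).
  by apply/mxOverP=> i j; rewrite mxE; apply/complex_realP; exists (X i j).
have /hermitian_spectral_diag_real /mxOverP dR := sXC.
have /hermitian_normalmx/orthomx_spectralP := sXC.
have := spectral_unit XC.
set P := spectralmx XC; set d := spectral_diag XC in dR * => uP XE.
pose c i := complex.Re (d 0 i).
have dE i : d 0 i = (c i)%:C%C.
  by have /complex_realP[k kE] := dR 0 i; rewrite /c kE.
exists [seq c i | i : 'I_n.+1]; split=> [_ /mapP[i _ ->]|q q0].
  apply: (psdmx_eigenvalue_ge0 pX).
  (* Being a root of the characteristic polynomial descends from [R[i]] to [R], so a complex
     eigenvector suffices: row [i] of [P], nonzero because [P] is invertible. *)
  rewrite eigenvalue_root_char -(fmorph_root (real_complex R)) map_char_poly.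
  rewrite -eigenvalue_root_char; apply/eigenvalueP; exists (row i P).
    rewrite -row_mul -/XC XE !mulmxA mulmxV // mul1mx row_mul row_diag_mx.
    by rewrite -scalemxAl -rowE dE.
  have /row_freeP[Q PQ] : row_free P by rewrite row_free_unit.
  apply/eqP=> r0; have := oner_neq0 R[i].
  have /matrixP/(_ 0 i) : row i (P *m Q) = 0 by rewrite row_mul r0 mul0mx.
  by rewrite PQ !mxE eqxx /= mulr1n => ->; rewrite eqxx.
apply: (map_mx_inj (f := real_complex R)); rewrite map_mx0 map_horner_mx -/XC.
rewrite XE horner_mx_uconjC // horner_mx_diag.
suff -> : map_mx (horner (map_poly (real_complex R) q)) d = 0.
  by rewrite raddf0 mulmx0 mul0mx.
apply/matrixP=> i j; rewrite !mxE ord1 dE horner_map q0 //.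
by apply: map_f; rewrite mem_enum.
Qed.

Lemma horner_mx_sym n (X : 'M[R]_n.+1) (q : {poly R}) :
  X^T = X -> (horner_mx X q)^T = horner_mx X q.
Proof.
move=> sX; elim/poly_ind: q => [|q c IH]; first by rewrite rmorph0 trmx0.
rewrite rmorphD rmorphM /= horner_mx_X horner_mx_C trmxD tr_scalar_mx trmx_mul.
by rewrite sX IH (comm_mx_horner q (erefl : comm_mx X X)).
Qed.

Lemma psdmx_sqrt_exists n (X : 'M[R]_n) : psdmx X ->
  exists S, psdmx S /\ S *m S = X.
Proof.
case: n X => [|n] X pX.
  by exists 0; split; [apply: psdmx0 | rewrite [RHS]flatmx0 mulmx0].
have [s [s_ge0 sP]] := psdmx_spectrum pX.
(* Fourth roots make the square root [T *m T] with [T] symmetric, a Gram matrix and so positive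
   semidefinite. *)
have [q qE] := interpolation s (fun x => Num.sqrt (Num.sqrt x)).
pose T := horner_mx X q.
have sT : T^T = T by apply: horner_mx_sym; case: pX.
exists (T *m T); split; first by rewrite -{1}sT; apply: psdmx_gram.
apply/eqP; rewrite -subr_eq0.
have -> : T *m T *m (T *m T) - X = horner_mx X (q * q * (q * q) - 'X).
  by rewrite rmorphB !rmorphM /= horner_mx_X.
apply/eqP/sP => x xs; rewrite !(hornerD, hornerN, hornerM, hornerX).
rewrite qE // -!expr2 !sqr_sqrtr ?sqrtr_ge0 ?s_ge0 //.
by rewrite subrr.
Qed.

Lemma sqrtmxP n (X : 'M[R]_n) :
  psdmx X -> psdmx (sqrtmx X) /\ sqrtmx X *m sqrtmx X = X.
Proof. by move=> /psdmx_sqrt_exists; apply: xgetPex. Qed.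

Lemma psdmx_sqrtmx n (X : 'M[R]_n) : psdmx X -> psdmx (sqrtmx X).
Proof. by case/sqrtmxP. Qed.

Lemma sqrtmxK n (X : 'M[R]_n) : psdmx X -> sqrtmx X *m sqrtmx X = X.
Proof. by case/sqrtmxP. Qed.

Lemma tr_sqrtmx n (X : 'M[R]_n) : psdmx X -> (sqrtmx X)^T = sqrtmx X.
Proof. by move=> /psdmx_sqrtmx[]. Qed.

Lemma sqrtmx_sqr n (S : 'M[R]_n) : psdmx S -> sqrtmx (S *m S) = S.
Proof.
move=> pS.
have pSS : psdmx (S *m S) by rewrite -{1}(proj1 pS); apply: psdmx_gram.
by apply: psdmx_sqrt_unique => //; [apply: psdmx_sqrtmx | apply: sqrtmxK].
Qed.

(** A polynomial in [X] serves as pseudoinverse: it is symmetric and commutes with [X], whence the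
    two symmetry conditions. *)
Lemma penrose_mp_pinv n (X : 'M[R]_n) : psdmx X -> penrose X (mp_pinv X).
Proof.
move=> pX; apply: xgetPex.
case: n X pX => [|n] X pX.
  by exists 0; split; rewrite [LHS]flatmx0 [RHS]flatmx0.
have [s [s_ge0 sP]] := psdmx_spectrum pX.
(* The convention [0^-1 = 0] gives the right value at a zero eigenvalue. *)
have [q qE] := interpolation s GRing.inv.
have sq := horner_mx_sym q (proj1 pX).
have cq : comm_mx X (horner_mx X q) := comm_mx_horner q (erefl : comm_mx X X).
exists (horner_mx X q); split; last 2 first.
- by rewrite trmx_mul sq (proj1 pX) -cq.
- by rewrite trmx_mul sq (proj1 pX) cq.
- apply/eqP; rewrite -subr_eq0.
  have -> : X *m horner_mx X q *m X - X = horner_mx X ('X * q * 'X - 'X).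
    by rewrite rmorphB !rmorphM /= horner_mx_X.
  apply/eqP/sP => x xs /=; rewrite !hornerE qE //.
  by have [->|x0] := eqVneq x 0; rewrite ?mulr0 ?subr0 // divff // mul1r subrr.
- apply/eqP; rewrite -subr_eq0.
  have -> : horner_mx X q *m X *m horner_mx X q - horner_mx X q =
      horner_mx X (q * 'X * q - q).
    by rewrite rmorphB !rmorphM /= horner_mx_X.
  apply/eqP/sP => x xs /=; rewrite !hornerE qE //.
  have [->|x0] := eqVneq x 0; first by rewrite invr0 mulr0 subr0.
  by rewrite mulVf // mul1r subrr.
Qed.

(** * Polar decomposition *)

(* The Householder reflection along x - y. *)
Lemma reflection_exists n (x y : 'cV[R]_n) : x^T *m x = y^T *m y ->
  exists Q : 'M[R]_n, [/\ Q^T *m Q = 1%:M, Q *m x = y &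
    forall z : 'cV_n, z^T *m x = z^T *m y -> Q *m z = z].
Proof.
move=> exy; have [->|nxy] := eqVneq x y.
  by exists 1%:M; split=> *; rewrite ?trmx1 ?mul1mx.
pose u := x - y; pose c := (u^T *m u) 0 0.
have uu : u^T *m u = c%:M by apply: mx11_scalar.
have c0 : c != 0.
  apply: contra nxy => /eqP c0; rewrite -subr_eq0; apply/eqP/gram_eq0.
  by rewrite -/u uu c0 raddf0.
(* As [x] and [y] have equal norms, [|x - y|^2 = 2 (x - y)^T x], so the reflection subtracts exactly
   [u] from [x]. *)
have cE : c%:M = 2 *: (u^T *m x).
  rewrite -uu /u trmxB !mulmxBl !mulmxBr exy.
  have -> : x^T *m y = y^T *m x 
    by rewrite [LHS]mx11_scalar -tr_scalar_mx -mx11_scalar trmx_mul trmxK.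
  by rewrite scalerDr scalerN [2]mulr2n !scalerDl !scale1r opprB addrACA -opprD.
pose Q : 'M[R]_n := 1%:M - (2 / c) *: (u *m u^T).
have sQ : Q^T = Q by rewrite trmxB trmxZ trmx1 trmx_mul trmxK.
exists Q; split.
- have PP : u *m u^T *m (u *m u^T) = c *: (u *m u^T).
    by rewrite mulmxA -[u *m u^T *m u]mulmxA uu mul_mx_scalar -scalemxAl.
  rewrite sQ /Q mulmxBl mul1mx mulmxBr mulmx1 -scalemxAl -scalemxAr PP !scalerA.
  have -> : 2 / c * (2 / c) * c = 2 / c + 2 / c by field.
  by rewrite scalerDl opprB addrK subrK.
- rewrite /Q mulmxBl mul1mx -scalemxAl -mulmxA [2 / c]mulrC -scalerA.
  rewrite scalemxAr -cE mul_mx_scalar scalerA mulVf // scale1r.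
  by rewrite /u opprB addrC subrK.
move=> z zxy; rewrite /Q mulmxBl mul1mx -scalemxAl -mulmxA.
have -> : u^T *m z = 0.
  by apply: trmx_inj; rewrite trmx_mul trmxK trmx0 /u mulmxBr zxy subrr.
by rewrite mulmx0 scaler0 subr0.
Qed.

Lemma col_mulmx m n p (X : 'M[R]_(m, n)) (Y : 'M[R]_(n, p)) i :
  col i (X *m Y) = X *m col i Y.
Proof. by rewrite !colE mulmxA. Qed.

(* Columns are matched one at a time: x - y is orthogonal to the columns already
   matched, so the reflection sending x to y fixes them. *)
Lemma gram_eq_orthogonal n k (X Y : 'M[R]_(n, k)) : X^T *m X = Y^T *m Y ->
  exists2 Q : 'M[R]_n, Q^T *m Q = 1%:M & X = Q *m Y.
Proof.
move=> eXY.
suff /(_ k (leqnn _)) [Q QQ QE] : forall j, (j <= k)%N ->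
    exists2 Q : 'M[R]_n, Q^T *m Q = 1%:M &
      forall i : 'I_k, (i < j)%N -> Q *m col i Y = col i X.
  exists Q => //; apply/matrixP=> a i.
  by have /matrixP/(_ a 0) := QE i (ltn_ord i); rewrite -col_mulmx !mxE.
elim=> [_|j IH jk]; first by exists 1%:M; rewrite ?trmx1 ?mulmx1.
have [Q QQ QE] := IH (ltnW jk); pose i0 := Ordinal jk.
have gramE (Z : 'M[R]_(n, k)) a b :
    (col a Z)^T *m col b Z = ((Z^T *m Z) a b)%:M.
  by rewrite tr_col -row_mul -col_mulmx [LHS]mx11_scalar !mxE.
have [|H [HH Hx Hfix]] := @reflection_exists n (Q *m col i0 Y) (col i0 X).
  by rewrite trmx_mul mulmxA -[_ *m Q^T *m Q]mulmxA QQ mulmx1 !gramE eXY.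
exists (H *m Q) => [|i].
  by rewrite trmx_mul mulmxA -[_ *m H^T *m H]mulmxA HH mulmx1.
rewrite ltnS leq_eqVlt => /predU1P[ij|ij].
  by have -> : i = i0; [apply: val_inj | rewrite -mulmxA].
rewrite -mulmxA QE // Hfix // gramE eXY -QE //.
by rewrite trmx_mul mulmxA -[_ *m Q^T *m Q]mulmxA QQ mulmx1 gramE.
Qed.

(** [K] and [sqrtmx (K^T *m K)] have the same Gram matrix. *)
Lemma polar_decomposition n (K : 'M[R]_n) :
  exists2 Q : 'M[R]_n, Q^T *m Q = 1%:M & K = Q *m sqrtmx (K^T *m K).
Proof.
apply: gram_eq_orthogonal; have pK := psdmx_gram K.
by rewrite tr_sqrtmx // sqrtmxK.
Qed.

(** If [K = Q H] is a polar decomposition, then [K K^T = (Q H Q^T)^2], and [Q H Q^T] has the trace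
    of [H]. *)
Lemma mxtrace_sqrt_gramC n (K : 'M[R]_n) :
  \tr (sqrtmx (K *m K^T)) = \tr (sqrtmx (K^T *m K)).
Proof.
have [Q QQ KE] := polar_decomposition K; have pK := psdmx_gram K.
set H := sqrtmx _ in KE *.
have pH : psdmx H by apply: psdmx_sqrtmx.
have -> : K *m K^T = (Q *m H *m Q^T) *m (Q *m H *m Q^T).
  rewrite !mulmxA -[_ *m Q^T *m Q]mulmxA QQ mulmx1 {1 2}KE trmx_mul (proj1 pH).
  by rewrite !mulmxA.
rewrite sqrtmx_sqr; first by rewrite -mulmxA mxtrace_mulC -mulmxA QQ mulmx1.
by rewrite -{1}[Q]trmxK; apply: psdmx_conj.
Qed.

(* With H = h h, |h - Q h|^2 = 2 tr H - 2 tr (Q H). *)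
Lemma mxtrace_le_sqrt_gram n (K : 'M[R]_n) :
  \tr K <= \tr (sqrtmx (K^T *m K)) /\
  (\tr K = \tr (sqrtmx (K^T *m K)) -> psdmx K).
Proof.
have [Q QQ KE] := polar_decomposition K; have pK := psdmx_gram K.
set H := sqrtmx _ in KE *.
have pH : psdmx H by apply: psdmx_sqrtmx.
set h := sqrtmx H.
have hh : h *m h = H by apply: sqrtmxK.
have sh : h^T = h by apply: tr_sqrtmx.
have tE : \tr ((h - Q *m h)^T *m (h - Q *m h)) = 2 * (\tr H - \tr K).
  rewrite trmxB trmx_mul sh mulmxBl !mulmxBr !mulmxA -[_ *m Q^T *m Q]mulmxA.
  rewrite QQ mulmx1 hh !linearB /=.
  have -> : \tr (h *m Q *m h) = \tr K.
    by rewrite mxtrace_mulC mulmxA hh KE mxtrace_mulC.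
  have -> : \tr (h *m Q^T *m h) = \tr K.
    by rewrite -mxtrace_tr !trmx_mul trmxK sh mxtrace_mulC -mulmxA hh KE.
  by ring.
split=> [|tKH].
  have := gram_tr_ge0 (h - Q *m h); rewrite tE; lra.
have /gram_tr_eq0/eqP : \tr ((h - Q *m h)^T *m (h - Q *m h)) = 0.
  by rewrite tE tKH subrr mulr0.
rewrite subr_eq0 => /eqP hQ.
by rewrite KE -hh mulmxA -hQ hh.
Qed.

(** * Aligned factors and geodesics *)

(** The squared Frobenius norm. *)
Definition sqnorm m n (X : 'M[R]_(m, n)) : R := \tr (X^T *m X).

Lemma sqnormB m n (X Y : 'M[R]_(m, n)) :
  sqnorm (X - Y) = sqnorm X + sqnorm Y - 2 * \tr (X^T *m Y).
Proof.
rewrite /sqnorm trmxB mulmxBl !mulmxBr !linearB /=.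
have -> : \tr (Y^T *m X) = \tr (X^T *m Y).
  by rewrite -mxtrace_tr trmx_mul trmxK.
ring.
Qed.

(** With [a] the square root of [X X^T], [W2sq] involves the Gram matrix of [Y^T a]; exchanging the
    order of the factors turns it into [Y^T a a Y = K^T K]. The correction is twice the gap in
    [mxtrace_le_sqrt_gram]. *)
Lemma W2sq_gram n (X Y : 'M[R]_n) (K := X^T *m Y) :
  W2sq (X *m X^T) (Y *m Y^T) =
  sqnorm (X - Y) - 2 * (\tr (sqrtmx (K^T *m K)) - \tr K).
Proof.
rewrite sqnormB /W2sq -/K /sqnorm; set a := sqrtmx (X *m X^T).
have pA := psdmx_gramr X.
have sa : a^T = a by apply: tr_sqrtmx.
have -> : a *m (Y *m Y^T) *m a = (Y^T *m a)^T *m (Y^T *m a).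
  by rewrite trmx_mul trmxK sa !mulmxA.
rewrite -mxtrace_sqrt_gramC trmx_mul trmxK sa.
have -> : Y^T *m a *m (a *m Y) = K^T *m K.
  by rewrite mulmxA -[_ *m a *m a]mulmxA sqrtmxK // /K trmx_mul trmxK !mulmxA.
rewrite [\tr (X *m _)]mxtrace_mulC [\tr (Y *m _)]mxtrace_mulC; ring.
Qed.

Lemma W2sq_gram_psd n (X Y : 'M[R]_n) : psdmx (X^T *m Y) ->
  W2sq (X *m X^T) (Y *m Y^T) = sqnorm (X - Y).
Proof.
move=> pK; rewrite W2sq_gram (proj1 pK) sqrtmx_sqr //; ring.
Qed.

Lemma sqnorm_ge0 m n (X : 'M[R]_(m, n)) : 0 <= sqnorm X.
Proof. exact: gram_tr_ge0. Qed.

Lemma sqnorm_eq0 m n (X : 'M[R]_(m, n)) : sqnorm X = 0 -> X = 0.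
Proof. exact: gram_tr_eq0. Qed.

Lemma sqnormZ m n (a : R) (X : 'M[R]_(m, n)) :
  sqnorm (a *: X) = a ^+ 2 * sqnorm X.
Proof. by rewrite /sqnorm trmxZ -scalemxAl -scalemxAr scalerA linearZ. Qed.

Lemma sqnormN m n (X : 'M[R]_(m, n)) : sqnorm (- X) = sqnorm X.
Proof. by rewrite -scaleN1r sqnormZ sqrrN expr1n mul1r. Qed.

Lemma W2sq_le_sqnorm n (X Y : 'M[R]_n) :
  W2sq (X *m X^T) (Y *m Y^T) <= sqnorm (X - Y) /\
  (W2sq (X *m X^T) (Y *m Y^T) = sqnorm (X - Y) -> psdmx (X^T *m Y)).
Proof.
rewrite W2sq_gram; have [le_tr eq_tr] := mxtrace_le_sqrt_gram (X^T *m Y).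
split=> [|e]; first lra.
by apply: eq_tr; lra.
Qed.

Lemma psdmx_trC m n (X Y : 'M[R]_(m, n)) : psdmx (X^T *m Y) -> psdmx (Y^T *m X).
Proof. by case=> s p; rewrite -[Y^T *m X]trmxK trmx_mul trmxK s. Qed.

(** A factor [b] of [B] may be rotated on the right. If [b^T X = Q H] is a polar decomposition, then
    [(b Q)^T X = H]. *)
Lemma aligned_factor n (X B : 'M[R]_n) : psdmx B ->
  exists2 Y : 'M[R]_n, Y *m Y^T = B & psdmx (X^T *m Y).
Proof.
move=> pB; pose b := sqrtmx B.
have [Q QQ bXE] := polar_decomposition (b^T *m X).
exists (b *m Q).
  rewrite trmx_mul mulmxA -[_ *m Q *m Q^T]mulmxA (mulmx1C QQ) mulmx1.
  by rewrite tr_sqrtmx // sqrtmxK.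
apply: psdmx_trC; rewrite trmx_mul -mulmxA bXE mulmxA QQ mul1mx.
exact/psdmx_sqrtmx/psdmx_gram.
Qed.

Lemma psdmx_factor n (X : 'M[R]_n) :
  psdmx X -> exists Y : 'M[R]_n, X = Y *m Y^T.
Proof. by move=> pX; exists (sqrtmx X); rewrite tr_sqrtmx // sqrtmxK. Qed.

(** [Num.sqrt] is 0 on negative numbers, so this is what allows [W2] to be squared back to
    [W2sq]. *)
Lemma W2sq_ge0 n (A B : 'M[R]_n) : psdmx A -> psdmx B -> 0 <= W2sq A B.
Proof.
move=> /psdmx_factor[X ->] /(aligned_factor X)[Y <- pXY].
by rewrite W2sq_gram_psd // sqnorm_ge0.
Qed.

Lemma sqr_W2 n (A B : 'M[R]_n) : psdmx A -> psdmx B -> W2 A B ^+ 2 = W2sq A B.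
Proof. by move=> pA pB; rewrite sqr_sqrtr // W2sq_ge0. Qed.

(* Equality in the triangle inequality, with squares:
   |b u - a v|^2 <= 0 for u = X - Y and v = Y - Z. *)
Lemma W2sq_split n (X Y Z : 'M[R]_n) (a b D : R) : 0 < a -> 0 < b ->
    sqnorm (X - Y) = a ^+ 2 * D -> sqnorm (Y - Z) = b ^+ 2 * D ->
    W2sq (X *m X^T) (Z *m Z^T) = (a + b) ^+ 2 * D ->
  psdmx (X^T *m Z) /\ b *: (X - Y) = a *: (Y - Z).
Proof.
move=> a0 b0 XYE YZE XZE; have [le_XZ eq_XZ] := W2sq_le_sqnorm X Z.
pose u := X - Y; pose v := Y - Z; pose t := \tr (u^T *m v).
have uv : sqnorm (X - Z) = a ^+ 2 * D + b ^+ 2 * D + 2 * t.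
  have -> : X - Z = u - (- v) by rewrite opprK addrA subrK.
  by rewrite sqnormB sqnormN mulmxN linearN /= -/t XYE YZE; ring.
have buav : sqnorm (b *: u - a *: v) =
    2 * (a * b) * (a * b * D - t).
  rewrite sqnormB !sqnormZ trmxZ -scalemxAl -scalemxAr scalerA linearZ /= -/t.
  by rewrite XYE YZE; ring.
have ab0 : 0 < 2 * (a * b) by rewrite !mulr_gt0.
(* The upper bound is the nonnegativity of [|b u - a v|^2]; the lower one is [le_XZ]. *)
have tE : t = a * b * D.
  apply/eqP; rewrite eq_le; apply/andP; split.
    have := sqnorm_ge0 (b *: u - a *: v).
    by rewrite buav pmulr_rge0 // subr_ge0.
  by move: le_XZ; rewrite XZE uv; nra.
split; first by apply: eq_XZ; rewrite XZE uv tE; ring.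
apply/eqP; rewrite -subr_eq0; apply/eqP/sqnorm_eq0.
by rewrite buav tE subrr mulr0.
Qed.

(* With E = Y' - Y one gets X^T E = 0 by uniqueness of square roots, hence
   X^T Y E^T = 0, hence Y E^T = 0 by coercivity, hence E E^T = 0. *)
Lemma aligned_factor_unique n (X Y Y' : 'M[R]_n) (a : R) : 0 < a ->
    psdmx (X^T *m Y) -> psdmx (X^T *m Y') -> Y *m Y^T = Y' *m Y'^T ->
    psdmx (X^T *m Y - a *: (Y^T *m Y)) ->
  Y' = Y.
Proof.
move=> a0 pY pY' eYY pa.
have eXY : X^T *m Y' = X^T *m Y.
  apply: psdmx_sqrt_unique => //.
  rewrite -{2}(proj1 pY) -{2}(proj1 pY') !trmx_mul trmxK !mulmxA.
  by rewrite -[X^T *m Y *m Y^T]mulmxA -[X^T *m Y' *m Y'^T]mulmxA eYY.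
have [E EE] : exists E, E = Y' - Y by exists (Y' - Y).
have Y'E : Y' = Y + E by rewrite EE addrC subrK.
have XE : X^T *m E = 0 by rewrite EE mulmxBr eXY subrr.
have sumE : Y *m E^T + E *m Y^T + E *m E^T = 0.
  move: eYY; rewrite Y'E trmxD mulmxDl !mulmxDr -!addrA => /eqP.
  by rewrite addrC -subr_eq subrr eq_sym => /eqP.
have XYE : X^T *m Y *m E^T = 0.
  have := congr1 (mulmx X^T) sumE.
  by rewrite !mulmxDr !mulmxA XE !mul0mx !addr0 mulmx0.
have YE : Y *m E^T = 0.
  apply: gram_tr_eq0.
  have := psdmx_tr_ge0 (psdmx_conj E^T pa).
  rewrite mulmxBr mulmxBl trmxK -[E *m _ *m _]mulmxA XYE mulmx0 sub0r.
  rewrite -scalemxAr -scalemxAl linearN linearZ /=.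
  rewrite oppr_ge0 pmulr_rle0 // => le0.
  apply/eqP; rewrite eq_le gram_tr_ge0 andbT trmx_mul trmxK.
  by move: le0; rewrite !mulmxA.
have /gramr_eq0 E0 : E *m E^T = 0.
  have EY : E *m Y^T = 0 by rewrite -[LHS]trmxK trmx_mul trmxK YE trmx0.
  by move: sumE; rewrite YE EY !add0r.
by rewrite Y'E E0 addr0.
Qed.

(** Take [Z] a factor of [C] aligned with [X], and [Y'] a factor of [Y Y^T] aligned with [Z].
    Additivity of the distances aligns [Y'] with [X] and puts [Z] on the segment from [Y'] to [X];
    coercivity then forces [Y' = Y]. *)
Lemma geodesic_point_unique n (X Y C : 'M[R]_n) (a b c D : R) :
    0 < a -> 0 < b -> 0 < c -> psdmx C ->
    psdmx (X^T *m Y) -> psdmx (X^T *m Y - c *: (Y^T *m Y)) ->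
    W2sq (Y *m Y^T) C = a ^+ 2 * D -> W2sq C (X *m X^T) = b ^+ 2 * D ->
    W2sq (Y *m Y^T) (X *m X^T) = (a + b) ^+ 2 * D ->
  exists2 Z, C = Z *m Z^T & b *: (Y - Z) = a *: (Z - X).
Proof.
move=> a0 b0 c0 pC pXY pc YC CX YX.
have [Z ZC pXZ] := aligned_factor X pC.
have [Y' Y'Y pZY'] := aligned_factor Z (psdmx_gramr Y).
have pY'Z := psdmx_trC pZY'; have pZX := psdmx_trC pXZ.
have [pY'X bE] : psdmx (Y'^T *m X) /\ b *: (Y' - Z) = a *: (Z - X).
  apply: (@W2sq_split _ _ _ _ a b D); rewrite -?W2sq_gram_psd //.
  - by rewrite Y'Y ZC.
  - by rewrite ZC.
  - by rewrite Y'Y.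
exists Z => //; rewrite -[Y in LHS](_ : Y' = Y) //.
by apply: (@aligned_factor_unique _ X Y Y' c) => //; apply: psdmx_trC.
Qed.

Lemma constant_speed_geodesicE n (A B : 'M[R]_n) (Gam : R -> 'M[R]_n) :
    constant_speed_geodesic A B Gam ->
  exists Y Z : 'M[R]_n, [/\ Y *m Y^T = A, Z *m Z^T = B, psdmx (Y^T *m Z) &
    forall t, 0 <= t <= 1 ->
      Gam t = ((1 - t) *: Y + t *: Z) *m ((1 - t) *: Y + t *: Z)^T].
Proof.
move=> [pG G0 G1 GW]; pose D := W2sq A B.
have i0 : 0 <= (0 : R) <= 1 by rewrite lexx ler01.
have i1 : 0 <= (1 : R) <= 1 by rewrite lexx ler01.
have ih : 0 <= (2^-1 : R) <= 1 by apply/andP; split; lra.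
have pA : psdmx A by rewrite -G0; apply: pG.
have pB : psdmx B by rewrite -G1; apply: pG.
(* Only the square of [s - t] enters, so [e] can be taken positive whatever the order of [s] and
   [t]. *)
have WE s t (e : R) : 0 <= s <= 1 -> 0 <= t <= 1 -> (s - t) ^+ 2 = e ^+ 2 ->
    W2sq (Gam s) (Gam t) = e ^+ 2 * D.
  move=> hs ht <-; rewrite -sqr_W2 ?GW //; try exact: pG.
  by rewrite exprMn real_normK ?num_real // sqr_W2.
have [X XE] := psdmx_factor (pG _ ih).
have [Y YA pXY] := aligned_factor X pA.
have [Z ZB pXZ] := aligned_factor X pB.
have [pYZ hE] : psdmx (Y^T *m Z) /\ 2^-1 *: (Y - X) = 2^-1 *: (X - Z).
  apply: (@W2sq_split _ _ _ _ 2^-1 2^-1 D); rewrite ?invr_gt0 ?ltr0n //;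
    rewrite -?W2sq_gram_psd ?YA ?ZB -?XE -?G0 -?G1 //; try exact: psdmx_trC.
  - by apply: WE => //; field.
  - by apply: WE => //; field.
  - by apply: WE => //; field.
have XYZ : X = 2^-1 *: Y + 2^-1 *: Z.
  have {hE} := congr1 (fun U => 2^-1 *: X + 2^-1 *: Z + U) hE.
  move=> /matrixP hE; apply/matrixP=> i j; move: (hE i j); rewrite !mxE; lra.
(* Coercivity of the midpoint towards either end: the difference is half of [V^T U]. *)
have pc (U V : 'M[R]_n) : psdmx (V^T *m U) -> X = 2^-1 *: U + 2^-1 *: V ->
    psdmx (X^T *m U - 2^-1 *: (U^T *m U)).
  move=> pVU ->; rewrite trmxD !trmxZ mulmxDl -!scalemxAl addrC addKr.
  by apply: psdmxZ => //; rewrite invr_ge0 ler0n.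
exists Y, Z; split=> // t /andP[t0 t1].
(* Each half is compared with the segment from the midpoint to its own end. The times 0, 1 and 1/2
   are set apart because [geodesic_point_unique] takes positive lengths. *)
have [th|th|->] := ltgtP t 2^-1.
- move: t0; rewrite le_eqVlt => /predU1P[<-|t0].
    by rewrite subr0 scale1r scale0r addr0 YA.
  have it : 0 <= t <= 1 by rewrite (ltW t0).
  have [|||||||||U -> UE] :=
    @geodesic_point_unique _ X Y (Gam t) t (2^-1 - t) 2^-1 D;
    rewrite ?subr_gt0 ?invr_gt0 ?ltr0n ?YA -?XE -?G0 //; try exact: pG.
  + exact: pc (psdmx_trC pYZ) XYZ.
  + by apply: WE => //; ring.
  + by apply: WE => //; ring.
  + by apply: WE => //; field.
  suff -> : U = (1 - t) *: Y + t *: Z by [].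
  move: UE; rewrite XYZ => /matrixP UE; apply/matrixP=> i j.
  by move: (UE i j); rewrite !mxE; lra.
- move: t1; rewrite le_eqVlt => /predU1P[->|t1].
    by rewrite subrr scale1r scale0r add0r ZB.
  have it : 0 <= t <= 1 by rewrite t0 ltW.
  have [|||||||||U -> UE] :=
    @geodesic_point_unique _ X Z (Gam t) (1 - t) (t - 2^-1) 2^-1 D;
    rewrite ?subr_gt0 ?invr_gt0 ?ltr0n ?ZB -?XE -?G1 //; try exact: pG.
  + by apply: (pc _ Y pYZ); rewrite addrC.
  + by apply: WE => //; ring.
  + by apply: WE => //; ring.
  + by apply: WE => //; field.
  suff -> : U = (1 - t) *: Y + t *: Z by [].
  move: UE; rewrite XYZ => /matrixP UE; apply/matrixP=> i j.
  by move: (UE i j); rewrite !mxE; lra.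
have -> : 1 - 2^-1 = 2^-1 :> R by field.
by rewrite -XYZ.
Qed.

(** [(P s)^T P t] is a combination with nonnegative coefficients of [X^T X], [X^T Y], [Y^T X] and
    [Y^T Y], so any two points of the segment are aligned and their distance is [|P s - P t|]. *)
Lemma aligned_path_geodesic n (X Y : 'M[R]_n)
    (P := fun t => (1 - t) *: X + t *: Y)
    (Gam := fun t => P t *m (P t)^T) :
  psdmx (X^T *m Y) -> constant_speed_geodesic (X *m X^T) (Y *m Y^T) Gam.
Proof.
move=> pXY; have pYX := psdmx_trC pXY.
split=> [t _|||s t /andP[s0 s1] /andP[t0 t1]].
- exact: psdmx_gramr.
- by rewrite /Gam /P subr0 scale1r scale0r addr0.
- by rewrite /Gam /P subrr scale1r scale0r add0r.
have pP : psdmx ((P s)^T *m P t).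
  rewrite /P trmxD !trmxZ mulmxDl !mulmxDr -!scalemxAl -!scalemxAr !scalerA.
  do ![apply: psdmxD]; apply: psdmxZ; rewrite ?mulr_ge0 ?subr_ge0 //;
    exact: psdmx_gram.
rewrite /W2 !W2sq_gram_psd //.
have -> : P s - P t = (s - t) *: (Y - X).
  by apply/matrixP=> i j; rewrite !mxE; ring.
by rewrite sqnormZ -[Y - X]opprB sqnormN sqrtrM ?sqr_ge0 // sqrtr_sqr.
Qed.

(** * Block form of the geodesics *)

Lemma mxrank_gramr m n (X : 'M[R]_(m, n)) : \rank (X *m X^T) = \rank X.
Proof.
have := mxrank_mul_ker X X^T; suff -> : (X :&: kermx X^T)%MS = 0.
  by rewrite mxrank0 addn0.
apply/eqP/rowV0P => v; rewrite sub_capmx => /andP[/submxP[w ->]].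
by move/sub_kermxP => XX; apply: gramr_eq0; rewrite trmx_mul mulmxA XX mul0mx.
Qed.

(** For [k] in the kernel, the trace of [k W k^T] is a sum of two nonnegative terms, so [X k^T = 0].
    This will make the leading block of [Gt] invertible. *)
Lemma gramD_psdmx_unit n (X P : 'M[R]_n) (a : R) : 0 < a -> X \in unitmx ->
  psdmx P -> a *: (X^T *m X) + P \in unitmx.
Proof.
move=> a0 uX pP; rewrite -row_free_unit -kermx_eq0; set W := _ + P.
have [k kE] : exists k, k = kermx W by exists (kermx W).
have kWk : k *m W *m k^T = 0 by rewrite kE mulmx_ker mul0mx.
have := congr1 mxtrace kWk.
rewrite mxtrace0 mulmxDr mulmxDl -scalemxAr -scalemxAl linearD linearZ /=.
have -> : k *m (X^T *m X) *m k^T = (X *m k^T)^T *m (X *m k^T).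
  by rewrite trmx_mul trmxK !mulmxA.
have tP : 0 <= \tr (k *m P *m k^T).
  by rewrite -{1}[k]trmxK; apply/psdmx_tr_ge0/psdmx_conj.
have tX := gram_tr_ge0 (X *m k^T).
move/eqP; rewrite paddr_eq0 ?(mulr_ge0 (ltW a0)) // mulf_eq0 gt_eqF //=.
move=> /andP[/eqP/gram_tr_eq0 XW _].
by rewrite -kE -trmx_eq0 -[_^T](mulKmx uX) XW mulmx0.
Qed.

Lemma mxrank_block_lower r m (X11 : 'M[R]_r) X21 (X22 : 'M[R]_m) :
  X11 \in unitmx -> \rank (block_mx X11 0 X21 X22) = (r + \rank X22)%N.
Proof.
move=> u11.
have -> : block_mx X11 0 X21 X22 =
    block_mx X11 0 X21 1%:M *m block_mx 1%:M 0 0 X22.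
  by rewrite mulmx_block !mulmx0 !mul0mx !mulmx1 mul1mx !addr0 add0r.
rewrite eqmxMfull ?rank_diag_block_mx ?mxrank1 //.
by rewrite row_full_unit unitmxE det_lblock det1 mulr1 -unitmxE.
Qed.

(** * The blocks of [M *m M^T] *)

Section PseudoinverseCompletion.
Context {r m : nat}.
Variables (B11 G11 S : 'M[R]_r) (B12 Z N : 'M[R]_(r, m)).
Hypotheses (pB11 : psdmx B11) (uG : G11 \in unitmx) (pS : psdmx S).
Hypotheses (SS : S *m S = G11^T *m B11 *m G11).
Hypotheses (B12E : B12 = B11 *m Z) (SN : S *m N = 0).
Let M11 := invmx G11^T *m S.
Let M21 := B12^T *m G11 *m mp_pinv S + N^T.

Let uGT : G11^T \in unitmx. Proof. by rewrite unitmx_tr. Qed.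

Let M11T : M11^T = S *m invmx G11.
Proof. by rewrite trmx_mul (proj1 pS) trmx_inv trmxK. Qed.

Let B12G : B12^T *m G11 = Z^T *m invmx G11^T *m (S *m S).
Proof. by rewrite SS B12E trmx_mul (proj1 pB11) !mulmxA mulmxKV. Qed.

Lemma completion11 : M11 *m M11^T = B11.
Proof.
rewrite M11T /M11 mulmxA -[_ *m S *m S]mulmxA SS !mulmxA.
by rewrite mulVmx // mul1mx mulmxK.
Qed.

(** [B12^T *m G11] has the form [_ *m S *m S], so multiplying it by [mp_pinv S *m S] changes
    nothing, while [N^T *m S = 0]. *)
Lemma completion21 : M21 *m M11^T = B12^T.
Proof.
have [SYS _ _ _] := penrose_mp_pinv pS.
have NS : N^T *m S = 0 by rewrite -(proj1 pS) -trmx_mul SN trmx0.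
rewrite M11T mulmxA mulmxDl NS addr0 B12G.
transitivity (Z^T *m invmx G11^T *m (S *m (S *m mp_pinv S *m S)) *m invmx G11).
  by rewrite !mulmxA.
by rewrite SYS SS !mulmxA mulmxK // mulmxKV // B12E trmx_mul (proj1 pB11).
Qed.

(** [S *m Y] is the orthogonal projection onto the range of [S]: it fixes [W^T] and kills [N]. The
    cross terms thus vanish, and what remains besides [N^T *m N] is [W *m W^T = Z^T *m B11 *m Z]. *)
Lemma completion22 : M21 *m M21^T = B12^T *m mp_pinv B11 *m B12 + N^T *m N.
Proof.
have [SYS _ sSY _] := penrose_mp_pinv pS; set Y := mp_pinv S in SYS sSY *.
have [BYB _ _ _] := penrose_mp_pinv pB11.
have SYN : S *m Y *m N = 0.
  by rewrite -sSY trmx_mul (proj1 pS) -mulmxA SN mulmx0.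
pose W := Z^T *m invmx G11^T *m S.
have M21E : M21 = W *m (S *m Y) + N^T by rewrite /M21 B12G -/Y /W !mulmxA.
have WW : W *m W^T = Z^T *m B11 *m Z.
  rewrite /W !trmx_mul (proj1 pS) trmxK trmx_inv trmxK !mulmxA.
  rewrite -[_ *m S *m S]mulmxA SS !mulmxA mulmxKV //.
  by rewrite -[_ *m G11 *m _]mulmxA mulmxV // mulmx1.
have NSY : N^T *m (S *m Y) = 0 by rewrite -sSY -trmx_mul SYN trmx0.
have SYW : S *m Y *m W^T = W^T.
  by rewrite /W [_^T]trmx_mul (proj1 pS) !mulmxA SYS.
rewrite M21E trmxD trmxK trmx_mul sSY mulmxDl !mulmxDr.
rewrite -[W *m _ *m N]mulmxA SYN mulmx0 addr0.
rewrite [N^T *m (_ *m W^T)]mulmxA NSY mul0mx add0r.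
rewrite SYW -[W *m _ *m W^T]mulmxA SYW WW; congr (_ + _).
by rewrite B12E trmx_mul (proj1 pB11) -[in LHS]BYB !mulmxA.
Qed.

End PseudoinverseCompletion.

(** * Block calculus in orthonormal bases of range and null space *)

Section Bases.
Context {n r m : nat}.
Variables (U1 : 'M[R]_(n, r)) (U2 : 'M[R]_(n, m)).
Hypothesis U11 : U1^T *m U1 = 1%:M.
Hypothesis U22 : U2^T *m U2 = 1%:M.
Hypothesis U21 : U2^T *m U1 = 0.
Hypothesis UU1 : U1 *m U1^T + U2 *m U2^T = 1%:M.
Local Notation U := (row_mx U1 U2).
Local Notation of_blocks := (of_blocks U1 U2).

Let U12 : U1^T *m U2 = 0.
Proof. by apply: trmx_inj; rewrite trmx_mul trmxK U21 trmx0. Qed.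

Let UTU : U^T *m U = 1%:M.
Proof. by rewrite tr_row_mx mul_col_row U11 U12 U21 U22 -scalar_mx_block. Qed.

Lemma of_blocksE (X : 'M[R]_n) :
  X = of_blocks (block U1 U1 X) (block U1 U2 X) (block U2 U1 X) (block U2 U2 X).
Proof.
have UUT : U *m U^T = 1%:M by rewrite tr_row_mx mul_row_col.
rewrite /Defs.of_blocks /block -mul_col_row -mul_col_mx -tr_row_mx.
by rewrite !mulmxA UUT mul1mx -mulmxA UUT mulmx1.
Qed.

Lemma of_blocks_mul a b c d a' b' c' d' :
  of_blocks a b c d *m of_blocks a' b' c' d' =
  of_blocks (a *m a' + b *m c') (a *m b' + b *m d')
            (c *m a' + d *m c') (c *m b' + d *m d').
Proof.
rewrite /Defs.of_blocks -mulmx_block !mulmxA; congr (_ *m _ *m _).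
by rewrite -[LHS]mulmxA UTU mulmx1.
Qed.

Lemma tr_of_blocks a b c d : (of_blocks a b c d)^T = of_blocks a^T c^T b^T d^T.
Proof. by rewrite /Defs.of_blocks !trmx_mul trmxK tr_block_mx mulmxA. Qed.

Lemma of_blocksD a b c d a' b' c' d' :
  of_blocks a b c d + of_blocks a' b' c' d' =
  of_blocks (a + a') (b + b') (c + c') (d + d').
Proof. by rewrite /Defs.of_blocks -add_block_mx mulmxDr mulmxDl. Qed.

Lemma of_blocksZ k a b c d :
  k *: of_blocks a b c d = of_blocks (k *: a) (k *: b) (k *: c) (k *: d).
Proof. by rewrite /Defs.of_blocks -scale_block_mx -scalemxAr -scalemxAl. Qed.

Lemma of_blocks_inj a b c d a' b' c' d' :
  of_blocks a b c d = of_blocks a' b' c' d' ->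
  [/\ a = a', b = b', c = c' & d = d'].
Proof.
move=> /(congr1 (fun X => U^T *m X *m U)).
rewrite /Defs.of_blocks !mulmxA UTU !mul1mx.
by rewrite -!mulmxA UTU !mulmx1 => /eq_block_mx.
Qed.

Lemma mxrank_of_blocks a b c d :
  \rank (of_blocks a b c d) = \rank (block_mx a b c d).
Proof.
apply/eqP; rewrite eqn_leq; apply/andP; split.
  by apply: leq_trans (mxrankM_maxl _ _) (mxrankM_maxr _ _).
have {1}-> : block_mx a b c d = U^T *m of_blocks a b c d *m U.
  by rewrite /Defs.of_blocks !mulmxA UTU mul1mx -mulmxA UTU mulmx1.
by apply: leq_trans (mxrankM_maxl _ _) (mxrankM_maxr _ _).
Qed.

Lemma psdmx_of_blocks11 a : psdmx a <-> psdmx (of_blocks a 0 0 0).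
Proof.
have E : of_blocks a 0 0 0 = U1 *m a *m U1^T.
  rewrite /Defs.of_blocks mul_row_block !mulmx0 !addr0 tr_row_mx.
  by rewrite mul_row_col mul0mx addr0.
split=> pa; first by rewrite E -{1}[U1]trmxK; apply: psdmx_conj.
have := psdmx_conj U1 pa; rewrite E !mulmxA U11 mul1mx -mulmxA U11 mulmx1.
by [].
Qed.

End Bases.

Lemma onb_range_null n r m (A : 'M[R]_n)
    (U1 : 'M[R]_(n, r)) (U2 : 'M[R]_(n, m)) :
    A^T = A -> onb_of U1 (colspace A) -> onb_of U2 (nullspace A) ->
  [/\ U2^T *m U1 = 0, U1 *m U1^T + U2 *m U2^T = 1%:M,
      A *m U2 = 0, r = \rank A & block U1 U1 A \in unitmx].
Proof.
move=> sA; rewrite /onb_of /nullspace /colspace sA.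
move=> [U11 /eqmxP eU1] [U22 /eqmxP eU2].
have AU2 : A *m U2 = 0.
  apply: trmx_inj; rewrite trmx_mul trmx0 sA; apply/sub_kermxP.
  by rewrite eU2.
have rE : r = \rank A.
  rewrite -eU1; apply/esym/eqP; change (row_free U1^T).
  by apply/row_freeP; exists U1.
have mE : (r + m)%N = n.
  have : \rank U2^T = m.
    by apply/eqP; change (row_free U2^T); apply/row_freeP; exists U2.
  by rewrite eU2 mxrank_ker rE => <-; rewrite subnKC ?rank_leq_row.
have U21 : U2^T *m U1 = 0.
  have /submxP[W U1E] : (U1^T <= A)%MS by rewrite eU1.
  have -> : U1 = A *m W^T by rewrite -[LHS]trmxK U1E trmx_mul sA.
  by rewrite mulmxA -[A in LHS]sA -trmx_mul AU2 trmx0 mul0mx.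
have U12 : U1^T *m U2 = 0 by rewrite -[LHS]trmxK trmx_mul trmxK U21 trmx0.
pose U := row_mx U1 U2.
have UTU : U^T *m U = 1%:M.
  by rewrite tr_row_mx mul_col_row U11 U12 U21 U22 -scalar_mx_block.
have UUT : U *m U^T = 1%:M.
  (* [U] has [r + m] columns, so its type is not square. By [mE], the full row rank of [U^T] is also
     full column rank. *)
  have : row_full U^T.
    rewrite /row_full -[X in _ == X]mE; change (row_free U^T).
    by apply/row_freeP; exists U.
  case/row_fullP => V VU; suff VE : V = U by rewrite -{1}VE.
  by rewrite -[V]mulmx1 -UTU mulmxA VU mul1mx.
have UU1 : U1 *m U1^T + U2 *m U2^T = 1%:M by rewrite -UUT tr_row_mx mul_row_col.
split=> //.
(* [A] factors through its leading block, whose rank is therefore at least [r]. *)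
have AE : A = U1 *m block U1 U1 A *m U1^T.
  have U2A : U2^T *m A = 0 by rewrite -[A]sA -trmx_mul AU2 trmx0.
  rewrite -[LHS]mul1mx -[LHS]mulmx1 -UU1 mulmxDl -[U2 *m _ *m A]mulmxA U2A.
  rewrite mulmx0 addr0 mulmxDr /block !mulmxA -[_ *m A *m U2]mulmxA AU2.
  by rewrite mulmx0 mul0mx addr0.
rewrite -row_free_unit -row_leq_rank {1}rE {1}AE.
by apply: leq_trans (mxrankM_maxl _ _) (mxrankM_maxr _ _).
Qed.

Lemma gram_mul_eq0 n p m k
    (S : 'M[R]_(n, p)) (K : 'M[R]_(k, p)) (N : 'M[R]_(p, m)) :
  S^T *m S = K^T *m K -> K *m N = 0 -> S *m N = 0.
Proof.
move=> eSK KN; apply: gram_eq0.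
by rewrite trmx_mul mulmxA -[_ *m S^T *m S]mulmxA eSK -!mulmxA KN !mulmx0.
Qed.

Lemma psdmx_block n p (U : 'M[R]_(n, p)) (X : 'M[R]_n) :
  psdmx X -> psdmx (block U U X).
Proof. exact: psdmx_conj. Qed.

Lemma tr_block n p q (U : 'M[R]_(n, p)) (V : 'M[R]_(n, q)) (X : 'M[R]_n) :
  X^T = X -> (block U V X)^T = block V U X.
Proof. by move=> sX; rewrite /block !trmx_mul trmxK sX mulmxA. Qed.

(** If [B = C C^T] and [D = U^T C], then the diagonal block is [D D^T], and [(1 - B11 Y) D] vanishes
    because its product with its transpose does. This provides the [Z] with [B12 = B11 *m Z]. *)
Lemma psdmx_block_range n p q
    (U : 'M[R]_(n, p)) (V : 'M[R]_(n, q)) (B : 'M[R]_n) :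
  psdmx B ->
  block U U B *m mp_pinv (block U U B) *m block U V B = block U V B.
Proof.
move=> pB; have pUB := psdmx_block U pB.
have [] := penrose_mp_pinv pUB; set B11 := block U U B in pUB *.
set Y := mp_pinv B11 => BYB _ _ _.
have [C BE] := psdmx_factor pB.
have B11E : B11 = U^T *m C *m (U^T *m C)^T.
  by rewrite /B11 /block BE trmx_mul trmxK !mulmxA.
suff CE : B11 *m Y *m (U^T *m C) = U^T *m C.
  rewrite /block BE -!mulmxA [U^T *m (C *m _)]mulmxA !mulmxA -/B11.
  by rewrite -[B11 *m Y *m U^T *m C]mulmxA CE.
apply/eqP; rewrite eq_sym -subr_eq0; apply/eqP/gramr_eq0.
rewrite -{1 3}[U^T *m C]mul1mx -mulmxBl [X in _ *m X]trmx_mul mulmxA.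
rewrite -[_ *m _ *m (U^T *m C)^T]mulmxA -B11E mulmxBl mul1mx BYB.
by rewrite subrr mul0mx.
Qed.

(** * Alignment of [G] and [M], rank, and the converse *)

Section Geodesics.
Context {n r m : nat}.
Variables (A B : 'M[R]_n) (U1 : 'M[R]_(n, r)) (U2 : 'M[R]_(n, m)).
Variable G11 : 'M[R]_r.
Hypotheses (pA : psdmx A) (pB : psdmx B).
Hypotheses (onb1 : onb_of U1 (colspace A)) (onb2 : onb_of U2 (nullspace A)).
Hypothesis (G11E : G11 *m G11^T = block U1 U1 A).
Local Notation B11 := (block U1 U1 B).
Local Notation B12 := (block U1 U2 B).
Local Notation B21 := (block U2 U1 B).
Local Notation G := (Gmx U1 U2 G11).
Local Notation S := (sqrtmx (G11^T *m B11 *m G11)).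
Local Notation admissible := (admissible U1 U2 B G11).
Local Notation schur := (schur U1 U2 B).

Let U11 : U1^T *m U1 = 1%:M. Proof. by case: onb1. Qed.
Let U22 : U2^T *m U2 = 1%:M. Proof. by case: onb2. Qed.
Let onb := onb_range_null (proj1 pA) onb1 onb2.
Let U21 : U2^T *m U1 = 0. Proof. by case: onb. Qed.
Let UU1 : U1 *m U1^T + U2 *m U2^T = 1%:M. Proof. by case: onb. Qed.
Let AU2 : A *m U2 = 0. Proof. by case: onb. Qed.
Let rE : r = \rank A. Proof. by case: onb. Qed.

Let uG : G11 \in unitmx.
Proof. by case: onb => _ _ _ _; rewrite -G11E unitmx_mul => /andP[]. Qed.

Let pB11 : psdmx B11. Proof. exact: psdmx_block. Qed.
Let pGBG : psdmx (G11^T *m B11 *m G11). Proof. exact: psdmx_conj. Qed.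
Let pS : psdmx S. Proof. exact: psdmx_sqrtmx. Qed.
Let SS : S *m S = G11^T *m B11 *m G11. Proof. exact: sqrtmxK. Qed.
Let B21E : B12^T = B21. Proof. by apply: tr_block; case: pB. Qed.
Let B12E : B12 = B11 *m (mp_pinv B11 *m B12).
Proof. by rewrite mulmxA psdmx_block_range. Qed.

Lemma Gmx_gram : G *m G^T = A.
Proof.
rewrite /Gmx tr_of_blocks of_blocks_mul // !trmx0 !mulmx0 !mul0mx !addr0 G11E.
rewrite [RHS](of_blocksE UU1); congr of_blocks; rewrite /block.
- by rewrite -mulmxA AU2 mulmx0.
- by rewrite -[A](proj1 pA) -trmx_mul AU2 trmx0 mul0mx.
- by rewrite -mulmxA AU2 mulmx0.
Qed.

(** [S] and [sqrtmx B11 *m G11] have the same Gram matrix, hence the same null space. *)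
Lemma admissible_range (N : 'M[R]_(r, m)) :
  (colspace N <= nullspace (sqrtmx B11 *m G11))%MS <-> S *m N = 0.
Proof.
have SK : S^T *m S = (sqrtmx B11 *m G11)^T *m (sqrtmx B11 *m G11).
  rewrite (proj1 pS) SS trmx_mul tr_sqrtmx // [RHS]mulmxA.
  by rewrite -[G11^T *m sqrtmx _ *m _]mulmxA sqrtmxK.
rewrite /nullspace /colspace; split=> [/sub_kermxP|].
  rewrite -trmx_mul => /(congr1 trmx); rewrite trmxK trmx0.
  exact: gram_mul_eq0.
move=> /(gram_mul_eq0 (esym SK)) KN; apply/sub_kermxP.
by rewrite -trmx_mul KN trmx0.
Qed.

Lemma Mmx_gram N M22 : S *m N = 0 -> M22 *m M22^T = schur - N^T *m N ->
  Mmx U1 U2 B G11 N M22 *m (Mmx U1 U2 B G11 N M22)^T = B.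
Proof.
move=> SN M22E; have c11 := completion11 uG pS SS.
have := completion21 pB11 uG pS SS B12E SN.
have := completion22 pB11 uG pS SS B12E SN.
rewrite B21E /Mmx /=.
set M11 := invmx _ *m S in c11 *; set M21 := _ + N^T => c22 c21.
rewrite tr_of_blocks of_blocks_mul // trmx0 !mulmx0 !mul0mx !addr0.
rewrite c11 c21 c22 M22E.
have -> : M11 *m M21^T = B12.
  by rewrite -[LHS]trmxK trmx_mul trmxK c21 -B21E trmxK.
rewrite [RHS](of_blocksE UU1); congr of_blocks.
by rewrite /Defs.schur addrACA subrr addr0 addrC subrK.
Qed.

(** The alignment of [G] and [M]: the leading block of [M] is chosen so that [G11^T] times it is
    [S]. *)
Lemma Gmx_Mmx N M22 : G^T *m Mmx U1 U2 B G11 N M22 = of_blocks U1 U2 S 0 0 0.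
Proof.
rewrite /Gmx /Mmx /= tr_of_blocks of_blocks_mul //.
rewrite !trmx0 !mulmx0 !mul0mx !addr0.
by rewrite mulmxA mulmxV ?unitmx_tr // mul1mx.
Qed.

Lemma Gammat_geodesic N M22 : S *m N = 0 -> M22 *m M22^T = schur - N^T *m N ->
  constant_speed_geodesic A B (Gammat U1 U2 B G11 N M22).
Proof.
move=> SN M22E; rewrite -{1}Gmx_gram -{1}(Mmx_gram SN M22E).
apply: aligned_path_geodesic; rewrite Gmx_Mmx.
exact/(psdmx_of_blocks11 U2 U11).
Qed.

Lemma GtE N M22 t : Gt U1 U2 B G11 N M22 t =
  of_blocks U1 U2 ((1 - t) *: G11 + t *: (invmx G11^T *m S)) 0
    (t *: (B21 *m G11 *m mp_pinv S + N^T)) (t *: M22).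
Proof. by rewrite /Gt !of_blocksZ of_blocksD !scaler0 !add0r. Qed.

(** [Gt] is block lower triangular. For [t < 1] its leading block is invertible, since [G11^T] times
    it is [(1 - t) G11^T G11 + t S]; for [t > 0] the scalar in [t *: M22] preserves the rank. *)
Lemma mxrank_Gammat N M22 t : 0 < t < 1 ->
  \rank (Gammat U1 U2 B G11 N M22 t) = (\rank A + \rank (M22 *m M22^T))%N.
Proof.
move=> /andP[t0 t1]; rewrite /Gammat !mxrank_gramr GtE mxrank_of_blocks //.
rewrite mxrank_block_lower ?mxrank_scale_nz ?gt_eqF // -?rE //.
set X := _ + _; suff : G11^T *m X \in unitmx by rewrite unitmx_mul => /andP[].
rewrite /X mulmxDr -!scalemxAr mulmxA mulmxV ?unitmx_tr // mul1mx.
apply: gramD_psdmx_unit => //; first by rewrite subr_gt0.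
by apply: psdmxZ => //; apply: ltW.
Qed.

Lemma geodesic_Gammat (M22 : 'M[R]_(r, m) -> 'M[R]_m) (Gam : R -> 'M[R]_n) :
    (forall N, admissible N -> M22 N *m (M22 N)^T = schur - N^T *m N) ->
    constant_speed_geodesic A B Gam ->
  exists2 N, admissible N &
    forall t, 0 <= t <= 1 -> Gam t = Gammat U1 U2 B G11 N (M22 N) t.
Proof.
move=> M22E /constant_speed_geodesicE[Y [Z [YA ZB pYZ GamE]]].
have [Q QQ YQ] : exists2 Q, Q^T *m Q = 1%:M & Y^T = Q *m G^T.
  by apply: gram_eq_orthogonal; rewrite !trmxK YA Gmx_gram.
have QQT := mulmx1C QQ.
have GE : Y *m Q = G.
  by rewrite -[Y]trmxK YQ trmx_mul trmxK -mulmxA QQ mulmx1.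
have [V VE] : exists V, V = Z *m Q by exists (Z *m Q).
have VB : V *m V^T = B.
  by rewrite VE trmx_mul mulmxA -[_ *m Q *m _]mulmxA QQT mulmx1.
have pGV : psdmx (G^T *m V).
  have := psdmx_conj Q pYZ.
  by rewrite -GE VE trmx_mul !mulmxA.
have {}GamE t : 0 <= t <= 1 ->
    Gam t = ((1 - t) *: G + t *: V) *m ((1 - t) *: G + t *: V)^T.
  move=> /GamE ->; rewrite -GE VE !scalemxAl -mulmxDl trmx_mul mulmxA.
  by rewrite -[_ *m Q *m _]mulmxA QQT mulmx1.
have := of_blocksE UU1 V.
set V11 := block U1 U1 V; set V12 := block U1 U2 V.
set V21 := block U2 U1 V; set V22 := block U2 U2 V => VbE.
have GV : G^T *m V = of_blocks U1 U2 (G11^T *m V11) (G11^T *m V12) 0 0.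
  by rewrite VbE /Gmx tr_of_blocks of_blocks_mul // !trmx0 !mul0mx !addr0.
(* The second block row of [G^T V] is zero, so its symmetry kills the block above the diagonal. *)
have [_ GV12 _ _] : [/\ (G11^T *m V11)^T = G11^T *m V11, 0 = G11^T *m V12,
    (G11^T *m V12)^T = 0 & 0^T = 0 :> 'M[R]_m].
  apply: (of_blocks_inj U11 U22 U21).
  rewrite -[X in of_blocks U1 U2 _ X _ _](trmx0 R m r) -tr_of_blocks -GV.
  by case: pGV.
have V12E : V12 = 0.
  by rewrite -[V12](mulKmx (_ : G11^T \in unitmx)) ?unitmx_tr // -GV12 mulmx0.
have pGV11 : psdmx (G11^T *m V11).
  by apply/(psdmx_of_blocks11 U2 U11); rewrite GV -GV12 in pGV.
have [B11E B12E' B21E' B22E] : [/\ V11 *m V11^T = B11, V11 *m V21^T = B12,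
    V21 *m V11^T = B21 & V21 *m V21^T + V22 *m V22^T = block U2 U2 B].
  apply: (of_blocks_inj U11 U22 U21); rewrite -(of_blocksE UU1).
  rewrite -[RHS]VB VbE V12E tr_of_blocks of_blocks_mul //.
  by rewrite trmx0 !mulmx0 !mul0mx !addr0.
have SE : S = G11^T *m V11.
  rewrite -[RHS]sqrtmx_sqr // -{2}(proj1 pGV11) trmx_mul trmxK -B11E.
  by rewrite !mulmxA.
have [SYS _ _ _] := penrose_mp_pinv pS.
pose N := (V21 - B21 *m G11 *m mp_pinv S)^T.
have V21E : B21 *m G11 *m mp_pinv S + N^T = V21 by rewrite trmxK addrC subrK.
(* [B21 = V21 V11^T] fixes [V21] on the range of [S] only; the remainder [N^T] vanishes there. *)
have V21S : V21 *m S = B21 *m G11.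
  by rewrite -B21E' -(proj1 pS) SE trmx_mul trmxK mulmxA.
have SN : S *m N = 0.
  apply: trmx_inj; rewrite trmx_mul trmx0 trmxK (proj1 pS) mulmxBl.
  by rewrite -V21S -[V21 *m S *m _]mulmxA -[V21 *m _ *m S]mulmxA SYS subrr.
have M11E : invmx G11^T *m S = V11 by rewrite SE mulKmx // unitmx_tr.
have V22E : V22 *m V22^T = schur - N^T *m N.
  have := completion22 pB11 uG pS SS B12E SN.
  rewrite B21E V21E /Defs.schur -B22E => ->.
  by rewrite -[RHS]addrA -opprD [RHS]addrC addKr.
have aN : admissible N.
  split; first exact/admissible_range.
  by rewrite /loewner_le -V22E; apply: psdmx_gramr.
(* [V22] and [M22 N] may differ, but the path depends on them only through their equal products with
   their transposes. *)
exists N => // t t01; rewrite GamE // /Gammat GtE M11E V21E.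
rewrite VbE V12E /Gmx !of_blocksZ of_blocksD !scaler0 !add0r.
rewrite !tr_of_blocks !of_blocks_mul // !trmx0 !mulmx0 !mul0mx !addr0.
by rewrite !trmxZ -!scalemxAl -!scalemxAr M22E // V22E.
Qed.

End Geodesics.

End BuresWassersteinGeodesics.

Theorem theorem4p10 (R : realType) (n r m : nat) (A B : 'M[R]_n)
    (U1 : 'M[R]_(n, r)) (U2 : 'M[R]_(n, m)) (G11 : 'M[R]_r)
    (M22 : 'M[R]_(r, m) -> 'M[R]_m)
    (hA : psdmx A) (hB : psdmx B) (hrank : (\rank B <= \rank A)%N)
    (hU1 : onb_of U1 (colspace A)) (hU2 : onb_of U2 (nullspace A))
    (hG11 : G11 *m G11^T = block U1 U1 A)
    (hM22 : forall N12, admissible U1 U2 B G11 N12 ->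
       M22 N12 *m (M22 N12)^T = schur U1 U2 B - N12^T *m N12) :
  let Gamma N12 := Gammat U1 U2 B G11 N12 (M22 N12) in
  [/\ forall N12, admissible U1 U2 B G11 N12 ->
        constant_speed_geodesic A B (Gamma N12) /\
        (forall s t : R, 0 <= t -> t <= s -> s <= 1 ->
           W2 (Gamma N12 s) (Gamma N12 t) = (s - t) * W2 A B),
      forall Gam : R -> 'M[R]_n, constant_speed_geodesic A B Gam ->
        exists2 N12 : 'M[R]_(r, m), admissible U1 U2 B G11 N12 &
          forall t : R, 0 <= t <= 1 -> Gam t = Gamma N12 t
    & forall N12, admissible U1 U2 B G11 N12 ->
        forall t : R, 0 < t < 1 ->
          \rank (Gamma N12 t) =
            (\rank A + \rank (schur U1 U2 B - N12^T *m N12)%R)%N].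
Proof.
move=> Gamma; split=> [N aN|Gam|N aN t t01].
- have [/(admissible_range U1 G11 hB) SN _] := aN.
  have geo := Gammat_geodesic hA hB hU1 hU2 hG11 SN (hM22 N aN).
  split=> // s t t0 ts s1; have [_ _ _ ->] := geo.
  + by rewrite ger0_norm // subr_ge0.
  + by rewrite (le_trans t0).
  + by rewrite t0 (le_trans ts).
- exact: geodesic_Gammat.
- by rewrite (mxrank_Gammat hA hB hU1 hU2 hG11) // hM22.
Qed.
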